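(* Let $p\ge5$ be a prime with Legendre symbol $\left(\frac{-3}{p}\right)=-1$, and let $\alpha\ge0$, $n\ge0$ be integers. Then for every $i\in\{1,2,\dots,p-1\}$, $$\overline{S_9}\big(6p^{2\alpha+2}n+(6i+p)p^{2\alpha+1}\big)\equiv0\pmod 3.$$
   Context: For $|q|<1$ and a positive integer $k$, write $f_k=\prod_{j\ge1}(1-q^{kj})$. The function $\overline{S_9}(n)$ (number of $9$-Schur overpartitions of $n$) is defined by $\sum_{n\ge0}\overline{S_9}(n)q^n=\prod_{n\ge1}\frac{(1+q^{2n-1})(1-q^{9(2n-1)})}{(1+q^{9(2n-1)})(1-q^{2n-1})}=\frac{f_2^3f_9^2f_{36}}{f_1^2f_4f_{18}^3}$. *)

(* Defs.v *)
From HB Require Import structures.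
From mathcomp Require Import all_boot all_order all_algebra.

Set Implicit Arguments.
Unset Strict Implicit.
Unset Printing Implicit Defensive.

Import Order.TTheory GRing.Theory Num.Theory.
Local Open Scope ring_scope.

(* Formal power series, as coefficient sequences. *)
Definition fps (R : Type) : Type := nat -> R.

Definition fps_of_poly (R : nzRingType) (p : {poly R}) : fps R :=
  fun n => p`_n.

Definition fps_one (R : nzRingType) : fps R := fps_of_poly 1.

Definition fps_mul (R : nzRingType) (f g : fps R) : fps R :=
  fun n => \sum_(i < n.+1) f i * g (n - i)%N.

(* The first n coefficients of 1 / f, obtained by solving                    *)
(*   \sum_(i <= m) f (m - i) * g i = (m == 0)%:R                             *)
(* for g m, successively for m = 0, ..., n - 1; meaningful for f 0 a unit.   *)
Fixpoint fps_inv_coefs (R : comUnitRingType) (f : fps R) (n : nat) : seq R :=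
  if n is m.+1 then
    let s := fps_inv_coefs f m in
    rcons s (((m == 0)%:R - \sum_(i < m) f (m - i)%N * s`_i) / f 0%N)
  else [::].

Definition fps_inv (R : comUnitRingType) (f : fps R) : fps R :=
  fun n => (fps_inv_coefs f n.+1)`_n.

Definition fps_div (R : comUnitRingType) (f g : fps R) : fps R :=
  fps_mul f (fps_inv g).

Definition fps_prod (R : nzRingType) (F : nat -> fps R) (N : nat) : fps R :=
  \big[@fps_mul R/fps_one R]_(1 <= m < N.+1) F m.

(* The infinite product F 1 * F 2 * ..., for F m = 1 + O(q^m): by            *)
(* [fps_infprod_stable] its n-th coefficient is the eventual value of the    *)
(* n-th coefficient of the finite products, reached at the index n.          *)
Definition fps_infprod (R : nzRingType) (F : nat -> fps R) : fps R :=
  fun n => fps_prod F n n.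

(* (1 + q^(2m-1)) (1 - q^(9(2m-1))) / ((1 + q^(9(2m-1))) (1 - q^(2m-1)))     *)
Definition schur9_factor (m : nat) : fps int :=
  let k := (2 * m - 1)%N in
  fps_div (fps_of_poly ((1 + 'X^k) * (1 - 'X^(9 * k))))
          (fps_of_poly ((1 + 'X^(9 * k)) * (1 - 'X^k))).

(* Number of 9-Schur overpartitions of n. *)
Definition S9bar (n : nat) : int := fps_infprod schur9_factor n.

Definition legendre (a : int) (p : nat) : int :=
  if (p %| a)%Z then 0
  else if [exists x : 'I_p, ((x : nat)%:Z ^+ 2 == a %[mod p])%Z] then 1
  else -1.

Lemma size_fps_inv_coefs (R : comUnitRingType) (f : fps R) n :
  size (fps_inv_coefs f n) = n.
Proof. by elim: n => //= n IH; rewrite size_rcons IH. Qed.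

Lemma nth_fps_inv_coefs (R : comUnitRingType) (f : fps R) n i :
  (i < n)%N -> (fps_inv_coefs f n)`_i = fps_inv f i.
Proof.
elim: n => // n IH; rewrite ltnS leq_eqVlt => /predU1P[-> //|lt_in].
by rewrite /= nth_rcons size_fps_inv_coefs lt_in IH.
Qed.

Lemma fps_mulV (R : comUnitRingType) (f : fps R) :
  f 0%N \is a GRing.unit -> fps_mul f (fps_inv f) =1 fps_one R.
Proof.
move=> uf n; rewrite /fps_mul (reindex_inj rev_ord_inj) big_ord_recr /=.
rewrite subSS subnn subn0 {2}/fps_inv /= nth_rcons size_fps_inv_coefs ltnn eqxx.
rewrite mulrC divrK //.
under eq_bigr => i _ do rewrite subSS subKn ?(ltnW (ltn_ord i)) //.
under [X in _ + (_ - X)]eq_bigr => i _ do rewrite nth_fps_inv_coefs //.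
by rewrite addrC subrK /fps_one /fps_of_poly coef1.
Qed.

Lemma fps_mul_trunc (R : nzRingType) (f f' g g' : fps R) n :
  (forall i, (i <= n)%N -> f i = f' i) ->
  (forall i, (i <= n)%N -> g i = g' i) ->
  forall i, (i <= n)%N -> fps_mul f g i = fps_mul f' g' i.
Proof.
move=> ff gg i le_in; apply: eq_bigr => j _; rewrite ff ?gg //.
  by rewrite (leq_trans (leq_subr _ _)).
by rewrite (leq_trans _ le_in) // -ltnS.
Qed.

Lemma fps_mul1 (R : nzRingType) (f : fps R) : fps_mul (fps_one R) f =1 f.
Proof.
move=> n; rewrite /fps_mul big_ord_recl /fps_one /fps_of_poly coef1 mul1r subn0.
by rewrite big1 ?addr0 // => i _; rewrite coef1 mul0r.
Qed.

Lemma fps_infprod_stable (R : nzRingType) (F : nat -> fps R) :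
  (forall m i, (i < m)%N -> F m i = fps_one R i) ->
  forall n N, (n <= N)%N -> fps_prod F N n = fps_infprod F n.
Proof.
move=> F1 n N le_nN; rewrite /fps_infprod /fps_prod.
rewrite {1}/index_iota (_ : N.+1 - 1 = n + (N - n))%N; last first.
  by rewrite subn1 subnKC.
rewrite iotaD /index_iota subn1 /= add1n.
suff tr r i : (i <= n)%N ->
  (\big[@fps_mul R/fps_one R]_(m <- r ++ iota n.+1 (N - n)) F m) i =
  (\big[@fps_mul R/fps_one R]_(m <- r) F m) i by exact: tr.
elim: r i => [|a r IH] i le_in /=; last first.
  by rewrite !big_cons; apply: fps_mul_trunc le_in.
rewrite big_nil big_seq; move: i le_in.
apply: (big_ind (fun h : fps R => forall i, (i <= n)%N -> h i = fps_one R i)).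
- by [].
- move=> f g f1 g1 i le_in; rewrite -(fps_mul1 (fps_one R) i).
  exact: (fps_mul_trunc f1 g1 le_in).
- move=> m; rewrite mem_iota => /andP[lt_nm _] i le_in.
  by rewrite F1 // (leq_ltn_trans le_in).
Qed.

Lemma schur9_factor_trunc m i :
  (i < m)%N -> schur9_factor m i = fps_one int i.
Proof.
move=> lt_im; rewrite /schur9_factor; set k := (2 * m - 1)%N.
have lt_ik : (i < k)%N.
  by rewrite /k (leq_trans lt_im) // mul2n -addnn -addnBA ?leq_addr //;
     case: (m) lt_im.
have low (u v : int) j : (j <= i)%N ->
    fps_of_poly ((1 + u *: 'X^(9 * k)) * (1 + v *: 'X^k)) j = fps_one int j.
  move=> le_ji; have lt_jk := leq_ltn_trans le_ji lt_ik.
  have lt_j9 : (j < 9 * k)%N by rewrite (leq_trans lt_jk) // leq_pmull.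
  rewrite /fps_one /fps_of_poly mulrDl mul1r -scalerAl mulrDr mulr1 -scalerAr.
  rewrite -exprD !(coefD, coefZ, coefXn).
  rewrite !ltn_eqF //; last by rewrite (leq_trans lt_j9) // leq_addr.
  by rewrite !(mulr0, addr0).
have num j (le_ji : (j <= i)%N) :
    fps_of_poly ((1 + 'X^k) * (1 - 'X^(9 * k))) j = fps_one int j.
  by rewrite -(low (-1) 1 j le_ji) scaleN1r scale1r mulrC.
have den j (le_ji : (j <= i)%N) :
    fps_of_poly ((1 + 'X^(9 * k)) * (1 - 'X^k)) j = fps_one int j.
  by rewrite -(low 1 (-1) j le_ji) scaleN1r scale1r.
have den0 : fps_of_poly ((1 + 'X^(9 * k)) * (1 - 'X^k)) 0%N \is a @GRing.unit int.
  by rewrite den // /fps_one /fps_of_poly coef1 unitr1.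
rewrite /fps_div (fps_mul_trunc num (fun _ _ => erefl) (leqnn i)).
by rewrite -(fps_mulV den0) (fps_mul_trunc den (fun _ _ => erefl) (leqnn i)).
Qed.

Lemma S9bar_stable n N :
  (n <= N)%N -> fps_prod schur9_factor N n = S9bar n.
Proof. exact: fps_infprod_stable schur9_factor_trunc n N. Qed.

(* Main.v *)
Require Import Defs.
From HB Require Import structures.
From mathcomp Require Import all_boot all_order all_algebra.
From mathcomp Require Import zify ring.

Set Implicit Arguments.
Unset Strict Implicit.
Unset Printing Implicit Defensive.

Import Order.TTheory GRing.Theory Num.Theory.
Local Open Scope ring_scope.

(* Let s be the generating series of S9bar and phi(q) = sum of q^(k^2) over all
   integers k. Modulo 3 the Frobenius turns the product into s = (Q / P)^8 with
   P and Q the products of 1 + q^k and 1 - q^k over odd k, and the Jacobi triple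
   product, here in its finite q-binomial form, makes this
   s = T(-q) / T(q) with T = phi^4 = phi(q) phi(q^3), the theta series of
   x^2 + 3 y^2. The number of representations of an even positive number by this
   form is divisible by 3, so T = 1 + B with B odd and s = (1 - B) / (1 + B);
   comparing degrees 1 mod 3, the coefficient of q^N in s is the number of
   representations of N. For N as in the theorem there are none, because p is
   inert and divides N to an odd power. *)

(** * Gaussian binomials and the finite Jacobi triple product *)

Section QBinomial.

Variables (R : comNzRingType) (q : R).

Fixpoint qbin (n k : nat) : R :=
  match n, k with
  | _, 0 => 1
  | 0, _.+1 => 0
  | n'.+1, k'.+1 => qbin n' k' + q ^+ k * qbin n' k
  end.

Lemma qbin0 n : qbin n 0 = 1. Proof. by case: n. Qed.

Lemma qbinS n k : qbin n.+1 k.+1 = qbin n k + q ^+ k.+1 * qbin n k.+1.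
Proof. by []. Qed.

Lemma qbin_small n k : (n < k)%N -> qbin n k = 0.
Proof.
elim: n k => [|n IH] [|k] //; rewrite ltnS => lt_nk.
by rewrite qbinS !IH ?mulr0 ?addr0 // ltnW.
Qed.

Lemma qbinn n : qbin n n = 1.
Proof. by elim: n => // n IH; rewrite qbinS IH qbin_small ?mulr0 ?addr0. Qed.

(** The second Pascal rule. The two rules commute: expanding by the defining rule and then by this
    one (induction hypothesis) gives the same terms as the opposite order. *)
Lemma qbinS_dual n k :
  (k <= n)%N -> qbin n.+1 k.+1 = q ^+ (n - k) * qbin n k + qbin n k.+1.
Proof.
elim: n k => [|n IH] [|k] //.
- by move=> _; rewrite qbinS !qbin0 qbin_small // subn0 expr0; ring.
- move=> _; transitivity (1 + q ^+ 1 * (q ^+ n * 1 + qbin n 1)).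
    by rewrite qbinS qbin0 IH // subn0 qbin0.
  by rewrite qbin0 [qbin n.+1 1]qbinS qbin0 subn0 expr1 exprS; ring.
rewrite ltnS => le_kn.
have [->|lt_kn] : k = n \/ (k < n)%N by lia.
  by rewrite subnn qbinS qbinn !qbin_small //; ring.
transitivity (q ^+ (n - k) * qbin n k + qbin n k.+1 +
              q ^+ k.+2 * (q ^+ (n - k.+1) * qbin n k.+1 + qbin n k.+2)).
  by rewrite qbinS -!IH.
rewrite !qbinS subSS.
have -> : (n - k = (n - k.+1).+1)%N by lia.
rewrite !exprS; ring.
Qed.

Lemma qbin_sym n k : (k <= n)%N -> qbin n (n - k) = qbin n k.
Proof.
elim: n k => [|n IH] [|k] // ; first by rewrite subn0 qbinn.
rewrite ltnS => le_kn; rewrite subSS.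
have [->|lt_kn] : k = n \/ (k < n)%N by lia.
  by rewrite subnn qbin0 qbinn.
have -> : (n - k = (n - k.+1).+1)%N by lia.
rewrite qbinS_dual; last by lia.
rewrite qbinS IH //.
have -> : ((n - k.+1).+1 = n - k)%N by lia.
rewrite IH; last by lia.
have -> : (n - (n - k.+1) = k.+1)%N by lia.
by rewrite addrC.
Qed.

(** Difference of the two Pascal rules for [qbin n.+1 k.+1]. *)
Lemma qbin_ratio n k : (k <= n)%N ->
  qbin n k.+1 * (1 - q ^+ k.+1) = qbin n k * (1 - q ^+ (n - k)).
Proof.
move=> le_kn; apply/eqP; rewrite -subr_eq0; apply/eqP.
have /eqP := qbinS n k; rewrite qbinS_dual // -subr_eq0 => /eqP e.
by rewrite -[RHS]e; ring.
Qed.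

End QBinomial.

Definition natdist (m b : nat) : nat := (m - b) + (b - m).

(** By the dual Pascal rule, passing from [a] to [a.+1] multiplies the sum by one more factor; the
    reflection of [m] in [a + b] exchanges [a] and [b]. As both grow this becomes the Jacobi triple
    product at z = 1. *)
Lemma finite_jacobi_triple (R : comNzRingType) (x : R) a b :
  \sum_(m < (a + b).+1) x ^+ (natdist m b ^ 2) * qbin (x ^+ 2) (a + b) m =
  (\prod_(j < a) (1 + x ^+ (2 * j).+1)) * \prod_(j < b) (1 + x ^+ (2 * j).+1).
Proof.
pose F a b := \sum_(m < (a + b).+1) x ^+ (natdist m b ^ 2) * qbin (x ^+ 2) (a + b) m.
rewrite -/(F a b).
have FS c d : F c.+1 d = F c d * (1 + x ^+ (2 * c).+1).
  rewrite /F addSn big_ord_recl qbin0.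
  under eq_bigr => i _ do rewrite lift0 qbinS_dual -1?ltnS ?ltn_ord //
     mulrDr.
  rewrite big_split /= addrCA mulrDr [in RHS]mulr1 [RHS]addrC; congr (_ + _).
    rewrite big_distrl; apply: eq_bigr => i _ /=.
    rewrite -exprM [LHS]mulrA [RHS]mulrAC -!exprD; congr (x ^+ _ * _).
    have := ltn_ord i; rewrite /natdist ltnS => le_i.
    nia.
  rewrite big_ord_recr /= qbin_small // mulr0 addr0.
  by rewrite [RHS]big_ord_recl /= qbin0; congr (_ + _).
have FC c d : F c d = F d c.
  rewrite /F [in RHS](addnC d) (reindex_inj rev_ord_inj) /=; apply: eq_bigr => i _.
  have := ltn_ord i; rewrite ltnS => le_i; rewrite subSS qbin_sym //.
  congr (x ^+ _ * _); congr (_ ^ _)%N; rewrite /natdist; lia.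
have F0 d : F d 0%N = \prod_(j < d) (1 + x ^+ (2 * j).+1).
  elim: d => [|d IH]; last by rewrite FS big_ord_recr IH.
  by rewrite big_ord0 /F big_ord_recl big_ord0 qbin0 mulr1 addr0.
elim: a => [|a IH]; first by rewrite FC F0 big_ord0 mul1r.
by rewrite FS IH big_ord_recr /= mulrAC.
Qed.

(** * Representations by x^2 + 3 y^2 *)

Lemma size_free_order3 (T : eqType) (f : T -> T) (s : seq T) :
  uniq s -> {in s, forall x, f x \in s} -> {in s, forall x, f (f (f x)) = x} ->
  {in s, forall x, f x != x} -> (3 %| size s)%N.
Proof.
have [m] := ubnP (size s); elim: m s => // m IH [|x s] //= lt_s us cl f3 nfix.
have xxs : x \in x :: s by rewrite mem_head.
have fx : f x != x by apply: nfix.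
have ffx : f (f x) != x.
  by apply: contraNneq fx => e; apply/eqP; rewrite -[RHS](f3 x) // e.
have fffx : f (f x) != f x.
  by apply: contraNneq ffx => e; apply/eqP; rewrite -[RHS](f3 x) // !e.
have fxs : f x \in s by have := cl x xxs; rewrite inE (negPf fx).
have ffxs : f (f x) \in s.
  by have := cl (f x); rewrite !inE fxs orbT (negPf ffx) => /(_ isT).
case/andP: us => xs us.
(* Removing the orbit of [x], which has three distinct elements, leaves a shorter list still stable
   under [f]. *)
pose s' := rem (f (f x)) (rem (f x) s).
have us' : uniq (rem (f x) s) by apply: rem_uniq.
have ms' y : (y \in s') = [&& y != f (f x), y != f x & y \in s].
  by rewrite mem_rem_uniq // inE mem_rem_uniq.
have f2 : f (f x) \in rem (f x) s by rewrite mem_rem_uniq // inE fffx.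
have ss' : size s = (size s').+2.
  rewrite /s' !size_rem //.
  have : (0 < size (rem (f x) s))%N by case: (rem _ _) f2.
  rewrite size_rem //; lia.
rewrite ss' (_ : (size s').+3 = 3 + size s')%N // dvdn_addr //.
apply: IH => //; first by lia.
- exact: rem_uniq.
- move=> y; rewrite !ms' => /and3P[y2 y1 ys].
  have ys' : y \in x :: s by rewrite inE ys orbT.
  have inj u v : u \in x :: s -> v \in x :: s -> f u = f v -> u = v.
    by move=> us0 vs0 e; rewrite -(f3 u) // e f3.
  have := cl y ys'; rewrite inE => /orP[/eqP e|->].
    by case/eqP: y2; rewrite -e f3.
  rewrite andbT; apply/andP; split.
    by apply: contraNneq y1 => /inj -> //; rewrite inE fxs orbT.
  by apply: contraNneq xs => /inj <-.
- by move=> y; rewrite ms' => /and3P[_ _ ys]; apply: f3; rewrite inE ys orbT.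
- by move=> y; rewrite ms' => /and3P[_ _ ys]; apply: nfix; rewrite inE ys orbT.
Qed.

Definition qform (z : int * int) : int := z.1 ^+ 2 + 3 * z.2 ^+ 2.

Definition int_range (n : nat) : seq int :=
  [seq k%:Z - n%:Z | k <- iota 0 (2 * n).+1].

(** The size [n] of the search box is independent of [i], so that one truncated theta series serves
    all [i <= n]; by [mem_reps] no representation of such an [i] is missed. *)
Definition reps (n i : nat) : seq (int * int) :=
  [seq z <- [seq (x, y) | x <- int_range n, y <- int_range n] | qform z == i%:Z].

Lemma mem_int_range n (x : int) : (x \in int_range n) = (- n%:Z <= x <= n%:Z).
Proof.
apply/mapP/idP => [[k]|/andP[lo hi]].
  by rewrite mem_iota add0n => /andP[_ hk] ->; lia.
by exists (absz (x + n%:Z)); rewrite ?mem_iota; lia.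
Qed.

Lemma uniq_reps n i : uniq (reps n i).
Proof.
apply/filter_uniq/allpairs_uniq; try by move=> [a b] [c d] _ _ /= [-> ->].
  by rewrite map_inj_uniq ?iota_uniq // => a b /addIr [].
by rewrite map_inj_uniq ?iota_uniq // => a b /addIr [].
Qed.

Lemma mem_reps n i z : (i <= n)%N -> (z \in reps n i) = (qform z == i%:Z).
Proof.
case: z => x y le_in; rewrite mem_filter; apply: andb_idr => /eqP e.
apply: (allpairs_f (@pair int int));
  rewrite mem_int_range; move: e; rewrite /qform /=; nia.
Qed.

(** If 3 divides x^2 + 3 y^2 then 3 divides x, and (3 b)^2 + 3 a^2 = 3 (a^2 + 3 b^2). *)
Lemma reps_pow3 n j : (3 * j <= n)%N -> size (reps n (3 * j)) = size (reps n j).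
Proof.
move=> le_jn; rewrite -(size_map (fun z : int * int => (3 * z.2, z.1)) (reps n j)).
apply/perm_size/uniq_perm; rewrite ?uniq_reps ?map_inj_uniq ?uniq_reps //.
  by move=> [a b] [c d] /= [e ->]; congr (_, _); lia.
move=> [x y]; apply/idP/mapP => [|[[a b]]]; rewrite !mem_reps //; try lia.
  rewrite /qform /= => /eqP e.
  have [c ec] : exists c, x = 3 * c.
    exists (x %/ 3)%Z; move: e; rewrite [in X in X -> _](divz_eq x 3).
    have := divz_eq x 3; have := modz_ge0 x (isT : 3%:Z != 0).
    have := @ltz_pmod x 3 isT; move: (x %% 3)%Z (x %/ 3)%Z => r q h1 h2 e1 e.
    have [r0|[r1|r2]] : r = 0 \/ r = 1 \/ r = 2 by lia.
    - by rewrite e1 r0; lia.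
    - by exfalso; subst r; lia.
    - by exfalso; subst r; lia.
  exists (y, c); last by rewrite ec.
  by rewrite mem_reps /qform /=; nia.
by rewrite /qform /= => /eqP e [-> ->]; apply/eqP; nia.
Qed.

Lemma reps_mod3_eq2 n j : (3 * j + 2 <= n)%N -> reps n (3 * j + 2) = [::].
Proof.
move=> le_jn; case E: (reps _ _) => [//|[x y] s].
have : (x, y) \in reps n (3 * j + 2) by rewrite E mem_head.
rewrite mem_reps // /qform /= => /eqP e; exfalso.
have := divz_eq x 3; have := modz_ge0 x (isT : 3%:Z != 0); have := @ltz_pmod x 3 isT.
move: (x %% 3)%Z (x %/ 3)%Z => r q h1 h2 e1; subst x.
have : r = 0 \/ r = 1 \/ r = 2 by lia.
by case=> [r0|[r1|r2]]; subst r; lia.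
Qed.

(* Multiplication by a primitive cube root of unity acts freely on the
   nonzero representations of an even number. *)
Lemma reps_even n i :
  (0 < i <= n)%N -> ~~ odd i -> (3 %| size (reps n i))%N.
Proof.
case/andP=> i_gt0 le_in ev_i.
(* For x and y of equal parity, [rot] sends (x, y) to (-(x + 3 y)/2, (x - y)/2), the coordinates of
   (x + y sqrt(-3)) (-1 + sqrt(-3))/2. The parities agree because x^2 + 3 y^2 is even; the
   parametrization x = y + 2 k keeps the division exact. *)
pose rot (z : int * int) :=
  let k := ((z.1 - z.2) %/ 2)%Z in (- k - z.2 * 2, k).
have rotE y k : rot (y + k * 2, y) = (- k - y * 2, k).
  by rewrite /rot /= (_ : _ - y = k * 2) ?mulzK //; ring.
have par z : z \in reps n i -> exists y k, z = (y + k * 2, y).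
  case: z => x y; rewrite mem_reps // /qform /= => /eqP e.
  by exists y, ((x - y) %/ 2)%Z; congr pair; nia.
have rot_eq (y k : int) : - k - y * 2 = k + (- y - k) * 2 by ring.
apply: (@size_free_order3 _ rot); first exact: uniq_reps.
- move=> z zs; have [y [k ez]] := par z zs; move: zs; rewrite ez rotE.
  rewrite !mem_reps // /qform /= => /eqP <-; apply/eqP; ring.
- move=> z /par[y [k ->]]; rewrite rotE rot_eq rotE.
  rewrite (_ : - (- y - k) - k * 2 = (- y - k) + y * 2); last by ring.
  by rewrite rotE; congr pair; ring.
move=> z zs; have [y [k ez]] := par z zs; move: zs; rewrite ez rotE.
rewrite mem_reps // /qform /= => /eqP e; apply/eqP => -[e1 e2]; move: e; nia.
Qed.

(** * Congruence of polynomials modulo a power of the variable *)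

Section TruncatedCongruence.

Variable F : fieldType.
Implicit Types (p q r : {poly F}) (M : nat).

Definition eqmodX M p q := 'X^M %| p - q.

Lemma eqmodXP M p q :
  reflect (forall i, (i < M)%N -> p`_i = q`_i) (eqmodX M p q).
Proof.
rewrite /eqmodX; apply: (iffP idP) => [/dvdpP[r e] i lt_i|e].
  by apply/eqP; rewrite -subr_eq0 -coefB e coefMXn lt_i.
rewrite -(poly_take_drop M (p - q)) dvdp_addr ?dvdp_mull //.
rewrite (_ : take_poly M _ = 0) ?dvdp0 //; apply/polyP => i.
by rewrite coef_take_poly coef0; case: ifP => // /e e'; rewrite coefB e' subrr.
Qed.

Lemma eqmodX_refl M p : eqmodX M p p.
Proof. by rewrite /eqmodX subrr dvdp0. Qed.

Lemma eqmodX_sym M p q : eqmodX M p q -> eqmodX M q p.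
Proof. by rewrite /eqmodX -[p - q]opprB dvdpNr. Qed.

Lemma eqmodX_trans M q p r : eqmodX M p q -> eqmodX M q r -> eqmodX M p r.
Proof.
rewrite /eqmodX => h1 h2.
have -> : p - r = (p - q) + (q - r) by rewrite addrA subrK.
exact: dvdp_add.
Qed.

Lemma eqmodXM M p p' q q' :
  eqmodX M p p' -> eqmodX M q q' -> eqmodX M (p * q) (p' * q').
Proof.
rewrite /eqmodX => h1 h2.
rewrite (_ : _ - _ = (p - p') * q + p' * (q - q')); last by ring.
by apply: dvdp_add; [apply: dvdp_mulr | apply: dvdp_mull].
Qed.

Lemma eqmodXX M p q n : eqmodX M p q -> eqmodX M (p ^+ n) (q ^+ n).
Proof.
move=> e; elim: n => [|n IH]; first exact: eqmodX_refl.
by rewrite !exprS; apply: eqmodXM.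
Qed.

(** A nonzero constant term makes [r] coprime to ['X^M]. *)
Lemma eqmodX_cancel M r p q :
  r`_0 != 0 -> eqmodX M (r * p) (r * q) -> eqmodX M p q.
Proof.
move=> r0; rewrite /eqmodX -mulrBr Gauss_dvdpr //.
by rewrite coprimep_sym coprimep_expr // coprimepX /root horner_coef0.
Qed.

End TruncatedCongruence.

(** * Frobenius in characteristic 3 and comparison of degrees modulo 3 *)

Section CharacteristicThree.

Local Notation F3 := 'F_3.
Implicit Types p q : {poly F3}.

Lemma pchar_polyF3 : 3%N \in [pchar {poly F3}].
Proof. by rewrite pchar_poly pchar_Fp. Qed.

Lemma three_polyF3 : 3%:R = 0 :> {poly F3}.
Proof. exact: pcharf0 pchar_polyF3. Qed.

Lemma cube_sum (I : Type) (r : seq I) (G : I -> {poly F3}) :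
  (\sum_(i <- r) G i) ^+ 3 = \sum_(i <- r) G i ^+ 3.
Proof.
rewrite -(pFrobenius_autE pchar_polyF3) rmorph_sum.
by apply: eq_bigr => i _; exact: pFrobenius_autE.
Qed.

(** Cubing is additive in characteristic 3 and fixes the coefficients, which lie in the prime
    field. *)
Lemma cube_comp p : p ^+ 3 = p \Po 'X^3.
Proof.
rewrite comp_polyE -[in LHS](coefK p) poly_def.
rewrite cube_sum; apply: eq_bigr => i _.
rewrite exprZn -!exprM mulnC; congr (_ *: _).
by case: (p`_i) => [[|[|[|//]]] h]; apply: val_inj.
Qed.

Lemma coef_cube p i : (p ^+ 3)`_i = if (3 %| i)%N then p`_(i %/ 3) else 0.
Proof. by rewrite cube_comp coef_comp_poly_Xn. Qed.

(* If A is the part of B in degrees 1 mod 3, then B = A + C with C = B ^ 3 a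
   series in 'X^3, and (s - A) (1 + C) = 1 - C ^ 2 - A ^ 2 has no term in
   degrees 1 mod 3; hence neither has s - A. *)
Lemma coef_class1 (M : nat) (s B : {poly F3}) :
  (forall i, (i < M)%N -> ~~ odd i -> B`_i = 0) ->
  (forall j, (3 * j < M)%N -> B`_(3 * j) = B`_j) ->
  (forall j, (3 * j + 2 < M)%N -> B`_(3 * j + 2) = 0) ->
  eqmodX M (s * (1 + B)) (1 - B) ->
  forall i, (i < M)%N -> (i %% 3)%N = 1%N -> s`_i = B`_i.
Proof.
move=> B_even B3 B2 es.
case: M B_even B3 B2 es => [//|M] B_even B3 B2 es.
have B0 : B`_0 = 0 by exact: B_even.
pose C := B ^+ 3.
pose A := \poly_(i < M.+1) (if (i %% 3 == 1)%N then B`_i else 0).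
have eBA : eqmodX M.+1 B (A + C).
  apply/eqmodXP => i lt_i; rewrite coefD coef_poly lt_i coef_cube.
  have := ltn_pmod i (isT : (0 < 3)%N); have ei := divn_eq i 3.
  have [d|nd] := boolP (3 %| i)%N.
    by rewrite (eqP d) add0r -{1}(divnK d) mulnC B3 // mulnC divnK.
  rewrite addr0; case: eqP => // n1 lt3.
  have n0 : (i %% 3 != 0)%N := nd.
  by rewrite (_ : i = 3 * (i %/ 3) + 2)%N ?B2 //; lia.
have key : eqmodX M.+1 ((s - A) * (1 + C)) (1 - C ^+ 2 - A ^+ 2).
  (* The factor 1 - B + B^2 turns 1 + B into 1 + B^3 = 1 + C. What remains is to substitute A + C
     for B, up to multiples of 3. *)
  have h := eqmodXM es (eqmodX_refl M.+1 (1 - B + B ^+ 2)).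
  have e1 : s * (1 + B) * (1 - B + B ^+ 2) = s * (1 + C) by rewrite /C; ring.
  have e2 : (1 - B) * (1 - B + B ^+ 2) = 1 + B - B ^+ 2 - C.
    rewrite /C; transitivity (1 + B - B ^+ 2 - B ^+ 3 + 3%:R * (B ^+ 2 - B)); first by ring.
    by rewrite three_polyF3 mul0r addr0.
  rewrite e1 e2 in h; rewrite /eqmodX in h eBA *.
  have -> : (s - A) * (1 + C) - (1 - C ^+ 2 - A ^+ 2) =
     s * (1 + C) - (1 + B - B ^+ 2 - C) + (B - (A + C)) * (1 - B - (A + C))
     - 3%:R * (A * C) by ring.
  rewrite three_polyF3 mul0r subr0 dvdp_add //.
exact: dvdp_mulr.
have C0 j : ~~ (3 %| j)%N -> C`_j = 0 by move=> h; rewrite coef_cube (negPf h).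
have C00 : C`_0 = 0 by rewrite coef_cube dvdn0 div0n.
have A0 j : (j %% 3 != 1)%N -> A`_j = 0.
  by move=> h; rewrite coef_poly (negPf h) if_same.
move=> i; elim/ltn_ind: i => i IH lt_i i1.
have AB : A`_i = B`_i by rewrite coef_poly lt_i i1 eqxx.
apply/eqP; rewrite -AB -subr_eq0 -coefB; apply/eqP.
have /eqmodXP/(_ i lt_i) := key; rewrite mulrDr mulr1 [X in X = _ -> _]coefD.
(* [C] lives in positive degrees divisible by 3, so only coefficients of [s - A] at some j < i with
   j = 1 mod 3 enter, and these vanish by induction. *)
rewrite [((s - A) * C)`_i]coefM big1 ?addr0 => [->|[j /= lt_j] _]; last first.
  have [d|/C0->] := boolP (3 %| i - j)%N; last by rewrite mulr0.
  have [e|ne] := eqVneq j i; first by rewrite e subnn C00 mulr0.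
  have j1 : (j %% 3)%N = 1%N by lia.
  have ltj : (j < M.+1)%N by lia.
  by rewrite coefB IH ?coef_poly ?ltj ?j1 ?eqxx ?subrr ?mul0r //; lia.
rewrite !coefB coef1 (_ : C ^+ 2 = (B ^+ 2) ^+ 3); last by rewrite /C -!exprM.
rewrite coef_cube (negPf (_ : ~~ (3 %| i)%N)) ?/dvdn ?i1 //.
have -> : (A ^+ 2)`_i = 0.
  rewrite expr2 coefM big1 // => -[j /= lt_j] _.
  have [h|h] := eqVneq (j %% 3)%N 1%N; last by rewrite A0 ?mul0r.
  by rewrite [A`_(i - j)]A0 ?mulr0 //; lia.
by rewrite (_ : i == 0%N = false) ?subr0 //; lia.
Qed.

End CharacteristicThree.

(** * Reduction of the generating product modulo 3 *)

Section Reduction.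

Variable M : nat.
Implicit Types f g : fps int.

Definition red3 f : {poly 'F_3} := \poly_(i < M) (f i)%:~R.

Lemma red3_mul f g : eqmodX M (red3 (fps_mul f g)) (red3 f * red3 g).
Proof.
apply/eqmodXP => i lt_i; rewrite coef_poly lt_i coefM rmorph_sum.
apply: eq_bigr => -[j /= lt_j] _; rewrite rmorphM !coef_poly.
by rewrite !(leq_ltn_trans _ lt_i) ?leq_subr.
Qed.

Lemma red3_poly (p : {poly int}) : eqmodX M (red3 (fps_of_poly p)) (map_poly intr p).
Proof. by apply/eqmodXP => i lt_i; rewrite coef_poly lt_i coef_map. Qed.

Lemma eq_red3 f g : f =1 g -> red3 f = red3 g.
Proof. by move=> e; apply/polyP => i; rewrite !coef_poly e. Qed.

Lemma red3_div f g : g 0%N \is a GRing.unit ->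
  eqmodX M (red3 (fps_div f g) * red3 g) (red3 f).
Proof.
move=> ug.
have h1 := eqmodXM (red3_mul f (fps_inv g)) (eqmodX_refl M (red3 g)).
apply: eqmodX_trans h1 _; rewrite -mulrA -[X in eqmodX _ _ X]mulr1.
apply: eqmodXM (eqmodX_refl _ _) _; rewrite mulrC.
apply: eqmodX_trans (eqmodX_sym (red3_mul _ _)) _.
rewrite (eq_red3 (fps_mulV ug)); apply: eqmodX_trans (red3_poly _) _.
by rewrite rmorph1 eqmodX_refl.
Qed.

(** Over ['F_3] the ninth power is the substitution of ['X^9] for ['X], so 1 + X^(9k) and 1 - X^(9k)
    are the ninth powers of 1 + X^k and 1 - X^k. The denominator is cleared to avoid division. *)
Lemma red3_schur9_factor m (k := (2 * m - 1)%N) : (0 < m)%N ->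
  eqmodX M (red3 (schur9_factor m) * ((1 + 'X^k) ^+ 9 * (1 - 'X^k)))
           ((1 + 'X^k) * (1 - 'X^k) ^+ 9).
Proof.
move=> m_gt0; have k_gt0 : (0 < k)%N by rewrite /k; lia.
have cubeX (p : {poly 'F_3}) : p ^+ 9 = p \Po 'X^9.
  have e9 : 9%N = (3 * 3)%N by [].
  by rewrite e9 exprM (cube_comp p) (cube_comp (p \Po _)) -comp_polyA comp_Xn_poly -exprM.
have [e1 e2] : (1 + 'X^k : {poly 'F_3}) ^+ 9 = 1 + 'X^(9 * k) /\
               (1 - 'X^k : {poly 'F_3}) ^+ 9 = 1 - 'X^(9 * k).
  by rewrite (cubeX (1 + _)) (cubeX (1 - _)) comp_polyD comp_polyB comp_polyC
    !comp_Xn_poly -!exprM.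
rewrite e1 e2 /schur9_factor -/k.
set num := (X in fps_div (fps_of_poly X) _); set den := (X in fps_div _ (fps_of_poly X)).
have <- : map_poly intr den = (1 + 'X^(9 * k)) * (1 - 'X^k) :> {poly 'F_3}.
  by rewrite /den rmorphM rmorphD rmorphB !rmorph1 /= !map_polyXn.
have <- : map_poly intr num = (1 + 'X^k) * (1 - 'X^(9 * k)) :> {poly 'F_3}.
  by rewrite /num rmorphM rmorphD rmorphB !rmorph1 /= !map_polyXn.
apply: eqmodX_trans _ (red3_poly num).
have u : fps_of_poly den 0%N \is a @GRing.unit int.
  rewrite /fps_of_poly /den coefM big_ord1 !coefD coefN !coefXn !coef1.
  have -> : (0 == 9 * k)%N = false by lia.
  have -> : (0 == k)%N = false by lia.
  by rewrite oppr0 !addr0 mulr1 unitr1.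
apply: eqmodX_trans _ (red3_div _ u).
exact: eqmodXM (eqmodX_refl _ _) (eqmodX_sym (red3_poly _)).
Qed.

(** At ['X] and [- 'X] these are the truncations of P and Q, since all exponents are odd. *)
Definition odd_prod (n : nat) (x : {poly 'F_3}) := \prod_(j < n) (1 + x ^+ (2 * j).+1).

Lemma red3_schur9_prod n :
  eqmodX M (red3 (fps_prod schur9_factor n) *
             (odd_prod n 'X ^+ 9 * odd_prod n (- 'X)))
           (odd_prod n 'X * odd_prod n (- 'X) ^+ 9).
Proof.
pose P (s : seq nat) (x : {poly 'F_3}) := \prod_(j <- s) (1 + x ^+ (2 * j - 1)).
have PE x : odd_prod n x = P (index_iota 1 n.+1) x.
  rewrite /P big_add1 /= big_mkord; apply: eq_bigr => j _.
  by congr (1 + x ^+ _); lia.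
rewrite !PE /fps_prod.
have : all (fun m => 0 < m)%N (index_iota 1 n.+1).
  by apply/allP => m; rewrite mem_index_iota => /andP[].
elim: (index_iota _ _) => [_|m s IH /= /andP[m_gt0 /IH{}IH]].
  rewrite /P !big_nil !expr1n !mulr1.
  by apply: eqmodX_trans (red3_poly _) _; rewrite rmorph1 eqmodX_refl.
rewrite /P !big_cons -/(P s 'X) -/(P s (- 'X)).
apply: eqmodX_trans (eqmodXM (red3_mul _ _) (eqmodX_refl _ _)) _.
have h := eqmodXM (red3_schur9_factor m_gt0) IH.
have em : (- 'X) ^+ (2 * m - 1) = - 'X^(2 * m - 1) :> {poly 'F_3}.
  by rewrite exprNn -signr_odd (_ : odd _) ?expr1 ?mulN1r //; lia.
rewrite em; move: h; rewrite !exprMn.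
congr eqmodX; by ring.
Qed.

End Reduction.


(** * Inert primes and the values of x^2 + 3 y^2 *)

Lemma inert_qform (p : nat) (x y : int) : prime p -> (3 < p)%N ->
  legendre (- 3%:Z) p = -1 -> (p %| qform (x, y))%Z ->
  (p %| x)%Z /\ (p %| y)%Z.
Proof.
move=> p_pr p_gt3; rewrite /legendre; case: ifP => // _.
case: ifP => // /negbT/existsPn nres _; rewrite /qform /= => d.
have p_gt0 : 0 < p%:Z by rewrite ltz_nat prime_gt0.
have EuX (z : int) : (p %| z ^+ 2)%Z -> (p %| z)%Z.
  by rewrite !dvdzE /= abszX Euclid_dvdX // => /andP[].
have py : (p %| y)%Z.
  (* Otherwise let u invert y modulo p: then x u is a square root of -3 modulo p, which the Legendre
     symbol excludes. *)
  apply/negPn/negP => npy.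
  have cop : coprimez y p.
    by rewrite coprimezE coprime_sym prime_coprime //.
  have [[u v] /= e] := coprimezP _ _ cop.
  have r_ge0 := modz_ge0 (x * u) (lt0r_neq0 p_gt0).
  have r_lt := ltz_pmod (x * u) p_gt0.
  have lt_r : (absz ((x * u) %% p)%Z < p)%N by lia.
  have /negP[] := nres (Ordinal lt_r); rewrite /= gez0_abs //.
  rewrite eqz_mod_dvd.
  rewrite (_ : (x * u %% p)%Z = x * u - (x * u %/ p)%Z * p); last first.
    by rewrite {2}(divz_eq (x * u) p); ring.
  set q := (_ %/ _)%Z.
  have -> : (x * u - q * p) ^+ 2 - - 3%:Z =
    (x ^+ 2 + 3 * y ^+ 2) * u ^+ 2 + p%:Z * (q ^+ 2 * p - 2 * x * u * q)
    + 3 * (1 - (u * y) ^+ 2) by ring.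
  rewrite (_ : 1 - (u * y) ^+ 2 = p%:Z * (v * (1 + u * y))); last first.
    have -> : p%:Z * (v * (1 + u * y)) = (u * y + v * p) * (1 + u * y) - u * y * (1 + u * y) by ring.
    by rewrite e; ring.
  apply: rpredD; last by rewrite mulrCA dvdz_mulr.
  by rewrite rpredD // dvdz_mulr.
split=> //; apply: EuX; rewrite (_ : x ^+ 2 = x ^+ 2 + 3 * y ^+ 2 - 3 * y * y); last by ring.
by rewrite rpredB // dvdz_mull.
Qed.

(** Descent: p divides both x and y, and dividing them by p lowers the exponent by 2. At exponent 1
    this would force p to divide [m]. *)
Lemma qform_neq_odd_valuation (p a m : nat) (x y : int) :
  prime p -> (3 < p)%N -> legendre (- 3%:Z) p = -1 -> ~~ (p %| m)%N ->
  qform (x, y) != (p ^ (2 * a).+1 * m)%:Z.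
Proof.
move=> p_pr p_gt3 leg ndvd; have p_gt0 := prime_gt0 p_pr.
elim: a x y => [|a IH] x y; apply/eqP => e.
  have dN : (p %| qform (x, y))%Z by rewrite e dvdzE /= expnS -mulnA dvdn_mulr.
  have [/dvdzP[x' ex] /dvdzP[y' ey]] := inert_qform p_pr p_gt3 leg dN.
  have em : m%:Z = p%:Z * qform (x', y').
    apply: (@mulfI _ p%:Z); first by rewrite eqz_nat -lt0n.
    by move: e; rewrite /qform /= ex ey muln0 expn1 PoszM => <-; ring.
  by move/negP: ndvd; apply; have := dvdz_mulr (qform (x', y')) (dvdzz p);
    rewrite -em dvdzE.
have dN : (p %| qform (x, y))%Z by rewrite e dvdzE /= expnS -mulnA dvdn_mulr.
have [/dvdzP[x' ex] /dvdzP[y' ey]] := inert_qform p_pr p_gt3 leg dN.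
have /eqP := IH x' y'; apply; apply: (@mulfI _ (p%:Z ^+ 2)).
  by rewrite expf_neq0 // eqz_nat -lt0n.
transitivity (qform (x, y)); first by rewrite /qform /= ex ey; ring.
rewrite e (_ : (2 * a.+1).+1 = (2 + (2 * a).+1))%N; last by lia.
by rewrite expnD -mulnA PoszM -[(p ^ 2)%:Z]natz natrX natz.
Qed.

(** * Theta series from the finite triple product *)

Definition theta (R : comNzRingType) (n : nat) (x : R) : R :=
  \sum_(m < (n + n).+1) x ^+ (natdist m n ^ 2).

(** By [qbin_ratio], moving from distance [d] to [d.+1] from the centre changes the coefficient only
    by multiples of q^(n - d). This allows all Gaussian binomials of the triple product to be
    replaced by the central one. *)
Lemma qbin_near_center (R : comNzRingType) (q : R) n d : (d <= n)%N ->
  exists c, qbin q (n + n) (n + d) = qbin q (n + n) n + q ^+ (n.+1 - d) * c.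
Proof.
elim: d => [|d IH] le_dn; first by exists 0; rewrite addn0 mulr0 addr0.
have [c e] := IH (ltnW le_dn).
have le2 : (n + d <= n + n)%N by lia.
have r := qbin_ratio q le2.
(* What is left after factoring out q^(n - d), using n + d + 1 = (n - d) + (2 d + 1). *)
exists (q * c - qbin q (n + n) (n + d) + q ^+ d.*2.+1 * qbin q (n + n) (n + d).+1).
have -> : (n + d.+1 = (n + d).+1)%N by lia.
have r' : qbin q (n + n) (n + d).+1 = qbin q (n + n) (n + d) * (1 - q ^+ (n - d))
   + qbin q (n + n) (n + d).+1 * q ^+ (n + d).+1.
  by rewrite (_ : n - d = n + n - (n + d))%N -?r; [ring | lia].
rewrite {1}r' {1}mulrBr mulr1 {1}e.
have -> : ((n + d).+1 = (n.+1 - d.+1) + d.*2.+1)%N by lia.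
have -> : (n.+1 - d = (n.+1 - d.+1).+1)%N by lia.
have -> : (n - d = n.+1 - d.+1)%N by lia.
rewrite exprD exprS; ring.
Qed.

(** The triple product with [a] and [b] equal to [n], every binomial replaced by the central one.
    Here [theta n] is phi cut off at |k| <= n, with k = m - n. *)
Lemma sqr_odd_prod_theta (R : comNzRingType) (n : nat) (x : R) : exists c,
  (\prod_(j < n) (1 + x ^+ (2 * j).+1)) ^+ 2 =
  qbin (x ^+ 2) (n + n) n * theta n x + x ^+ (2 * n).+1 * c.
Proof.
rewrite expr2 -finite_jacobi_triple /theta.
suff h (m : 'I_(n + n).+1) : exists c,
    x ^+ (natdist m n ^ 2) * qbin (x ^+ 2) (n + n) m =
    qbin (x ^+ 2) (n + n) n * x ^+ (natdist m n ^ 2) + x ^+ (2 * n).+1 * c.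
  pose K := fun y => exists c, y = x ^+ (2 * n).+1 * c.
  suff [c e] : K (\sum_(m < (n + n).+1) (x ^+ (natdist m n ^ 2) *
     qbin (x ^+ 2) (n + n) m - qbin (x ^+ 2) (n + n) n * x ^+ (natdist m n ^ 2))).
    by exists c; rewrite -e sumrB -mulr_sumr addrC subrK.
  apply: big_ind => [|_ _ [a ->] [b ->]|m _]; first by exists 0; rewrite mulr0.
    by exists (a + b); rewrite mulrDr.
  by have [c ->] := h m; exists c; rewrite addrC addKr.
have [d [le_dn ed eq]] : exists d, [/\ (d <= n)%N, natdist m n = d &
    qbin (x ^+ 2) (n + n) m = qbin (x ^+ 2) (n + n) (n + d)].
  have := ltn_ord m; rewrite ltnS => le_m.
  have [h|h] := leqP n m.
    by exists (m - n)%N; split; rewrite ?subnKC //; rewrite /natdist; lia.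
  exists (n - m)%N; split; rewrite /natdist; try lia.
  by rewrite -(qbin_sym _ le_m); congr qbin; lia.
have [c e] := qbin_near_center (x ^+ 2) le_dn.
(* The error at distance d has exponent d^2 + 2 (n + 1 - d) = (d - 1)^2 + 2 n + 1. *)
exists (x ^+ (natdist d 1 ^ 2) * c).
rewrite eq e ed mulrDr [X in X + _]mulrC; congr (_ + _).
rewrite -exprM !mulrA -!exprD; congr (x ^+ _ * c).
by rewrite /natdist; nia.
Qed.

Lemma qbin_horner0 (R : comNzRingType) (q : {poly R}) n k :
  q.[0] = 0 -> (k <= n)%N -> (qbin q n k).[0] = 1.
Proof.
move=> q0; elim: n k => [|n IH] [|k] // le_kn; rewrite ?qbin0 ?hornerC //.
by rewrite qbinS hornerD IH // exprS -mulrA hornerM q0 mul0r addr0.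
Qed.

Lemma coef_comp_oppX (R : comNzRingType) (p : {poly R}) i :
  (p \Po (- 'X))`_i = (-1) ^+ i * p`_i.
Proof.
have e j : (- 'X) ^+ j = (-1) ^+ j *: 'X^j :> {poly R}.
  by rewrite -scaleN1r exprZn.
rewrite comp_polyE coef_sum.
under eq_bigr => j _ do rewrite e !coefZ coefXn.
have [lt_i|le_i] := ltnP i (size p).
  rewrite (bigD1 (Ordinal lt_i)) //= eqxx mulr1 mulrC big1 ?addr0 // => j ne.
  by rewrite (_ : i == j = false) ?mulr0 //; apply/eqP => eij; case/eqP: ne; apply/val_inj.
rewrite nth_default // mulr0 big1 // => j _; have lt_j := ltn_ord j.
have -> : (i == j) = false by rewrite gtn_eqF // (leq_trans lt_j le_i).
by rewrite /= !mulr0.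
Qed.

(** Write phi^4 as phi times phi^3; Frobenius makes the cube a sum of X^(3 y^2), so the product
    enumerates x^2 + 3 y^2. Both sides range over the same box, hence no bound on [i]. *)
Lemma theta_pow4_coef n i :
  (theta n ('X : {poly 'F_3}) ^+ 4)`_i = (size (reps n i))%:R.
Proof.
have thetaE : theta n ('X : {poly 'F_3}) = \sum_(x <- int_range n) 'X^(absz x ^ 2).
  rewrite /int_range big_map -[in iota _ _](subn0 (2 * n).+1) -/(index_iota _ _) big_mkord.
  rewrite /theta addnn -mul2n; apply: eq_bigr => m _.
  by congr ('X^(_ ^ 2)); rewrite /natdist; lia.
rewrite exprS thetaE cube_sum big_distrlr coef_sum /reps.
rewrite size_filter -sum1_count natr_sum [RHS]big_mkcond [RHS]big_allpairs_dep.
apply: eq_bigr => x _; rewrite coef_sum; apply: eq_bigr => y _ /=.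
rewrite -exprM -exprD coefXn eq_sym.
have -> : (`|x|%N ^ 2 + `|y|%N ^ 2 * 3 == i)%N = (qform (x, y) == i).
  by rewrite /qform /=; apply/eqP/eqP; nia.
by case: (qform _ == i).
Qed.

(** Cancelling P Q leaves s P^8 = Q^8. The squares of P and Q are theta values times the same
    central binomial G, which depends only on the square of the argument; G^4 then cancels too. Both
    cancelled factors have constant term 1. *)
Lemma S9bar_theta n :
  eqmodX n.+1 (red3 n.+1 S9bar * theta n 'X ^+ 4) (theta n (- 'X) ^+ 4).
Proof.
set M := n.+1.
have e1 : red3 M S9bar = red3 M (fps_prod schur9_factor n).
  apply/polyP => i; rewrite !coef_poly; case: ltnP => // lt_i.
  by rewrite S9bar_stable.
have h := red3_schur9_prod M n; rewrite -e1 in h.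
set s := red3 M S9bar in h *.
pose P := odd_prod n 'X; pose Q := odd_prod n (- 'X); rewrite -/P -/Q in h.
have odd0 (x : {poly 'F_3}) : x.[0] = 0 -> (odd_prod n x).[0] = 1.
  move=> x0; rewrite horner_prod big1 // => j _.
  by rewrite hornerD hornerC exprS hornerM x0 mul0r addr0.
have PQ0 : (P * Q)`_0 != 0.
  by rewrite -horner_coef0 hornerM !odd0 ?mul1r ?oner_eq0 ?hornerN ?hornerX ?oppr0.
have {}h : eqmodX M (s * P ^+ 8) (Q ^+ 8).
  apply: (eqmodX_cancel PQ0).
  have -> : P * Q * (s * P ^+ 8) = s * (P ^+ 9 * Q) by ring.
  by have -> : P * Q * Q ^+ 8 = P * Q ^+ 9 by ring.
pose G : {poly 'F_3} := qbin ('X ^+ 2) (n + n) n.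
have sq (x : {poly 'F_3}) : x ^+ 2 = 'X ^+ 2 -> 'X %| x ->
    eqmodX M (odd_prod n x ^+ 2) (G * theta n x).
  move=> x2 dx; have [c e] := sqr_odd_prod_theta n x.
  rewrite /eqmodX /odd_prod e x2 addrC addKr dvdp_mulr //.
  by apply: dvdp_trans (dvdp_exp2r _ dx); rewrite dvdp_exp2l //; lia.
have eP : eqmodX M (P ^+ 8) (G ^+ 4 * theta n 'X ^+ 4).
  by rewrite (exprM P 2 4) -exprMn; apply/eqmodXX/sq.
have eQ : eqmodX M (Q ^+ 8) (G ^+ 4 * theta n (- 'X) ^+ 4).
  by rewrite (exprM Q 2 4) -exprMn; apply/eqmodXX/sq; rewrite ?sqrrN ?dvdpNr.
have G0 : (G ^+ 4)`_0 != 0.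
  rewrite -horner_coef0 horner_exp qbin_horner0 ?expr1n ?oner_eq0 //; last by lia.
  by rewrite hornerXn expr0n.
apply: (eqmodX_cancel G0).
apply: eqmodX_trans _ eQ; apply: eqmodX_trans _ h.
rewrite mulrCA; exact: eqmodXM (eqmodX_refl _ _) (eqmodX_sym eP).
Qed.

(** * Coefficients as representation numbers, and the congruence *)

Lemma S9bar_reps N : (N %% 3 = 1)%N ->
  (S9bar N)%:~R = (size (reps N N))%:R :> 'F_3.
Proof.
move=> N1; pose T : {poly 'F_3} := theta N 'X ^+ 4.
have Tc i : T`_i = (size (reps N i))%:R by apply: theta_pow4_coef.
have T0 : T`_0 = 1.
  rewrite Tc; suff -> : reps N 0 = [:: (0, 0)] by [].
  apply: perm_small_eq => //; apply: uniq_perm => //; first exact: uniq_reps.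
  move=> [x y]; rewrite mem_reps // inE /qform /=; apply/eqP/eqP => [e|[-> ->] //].
  by congr pair; nia.
have Te i : (0 < i <= N)%N -> ~~ odd i -> T`_i = 0.
  move=> hi ev; rewrite Tc; have /dvdnP[k ->] := reps_even hi ev.
  by rewrite natrM (_ : 3%:R = 0) ?mulr0 //; apply: val_inj.
have thN : theta N (- 'X) = theta N 'X \Po (- 'X) :> {poly 'F_3}.
  by rewrite /theta raddf_sum; apply: eq_bigr => j _; rewrite /= comp_Xn_poly.
have h := S9bar_theta N; rewrite thN -rmorphXn -/T /= in h.
(* Up to degree N, the only even-degree term of T is its constant 1, so X -> -X just negates B = T -
   1. *)
have TN : eqmodX N.+1 (T \Po (- 'X)) (1 - (T - 1)).
  apply/eqmodXP => i lt_i; rewrite coef_comp_oppX !coefB coef1.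
  have [->|i_gt0] := posnP i; first by rewrite T0 expr0 /= subrr subr0 mulr1.
  rewrite subr0 sub0r -signr_odd.
  case ev : (odd i); first by rewrite expr1 mulN1r.
  by rewrite Te ?mulr0 ?oppr0 ?i_gt0 ?ev.
have B (i : nat) : (0 < i)%N -> (T - 1)`_i = T`_i.
  by move=> i_gt0; rewrite coefB coef1 (gtn_eqF i_gt0) subr0.
have B0 : (T - 1)`_0 = 0 by rewrite coefB coef1 T0 subrr.
have := @coef_class1 N.+1 (red3 N.+1 S9bar) (T - 1).
rewrite (addrC 1 (T - 1)) subrK => key.
have := key _ _ _ (eqmodX_trans h TN) N (ltnSn N) N1.
rewrite coef_poly ltnSn B; last by lia.
rewrite Tc; apply.
- move=> i lt_i ev; have [->//|i_gt0] := posnP i.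
  by rewrite B // Te ?i_gt0.
- move=> j lt_j; have [->|j_gt0] := posnP j; first by rewrite muln0.
  by rewrite !B ?muln_gt0 // !Tc reps_pow3.
- by move=> j lt_j; rewrite B ?addn_gt0 ?orbT // Tc reps_mod3_eq2.
Qed.
Theorem theorem3p4 (p : nat) (p_prime : prime p) (p_ge5 : (5 <= p)%N)
  (leg : legendre (- 3%:Z)%R p = (- 1%:Z)%R)
  (alpha n i : nat) (hi : (1 <= i <= p - 1)%N) :
  (S9bar (6 * p ^ (2 * alpha + 2) * n + (6 * i + p) * p ^ (2 * alpha + 1))%N
     = 0%:Z %[mod 3%:Z])%Z.
Proof.
set N := (_ + _)%N.
(* The cofactor of p^(2 alpha + 1) in N; it is prime to p because p does not divide 6 i. *)
pose m := (6 * (p * n + i) + p)%N.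
have eN : N = (p ^ (2 * alpha).+1 * m)%N.
  by rewrite /N /m addn1 addn2 !expnS; ring.
have ndvd : ~~ (p %| m)%N.
  rewrite /m dvdn_addl // (_ : 6 = 2 * 3)%N // !Euclid_dvdM // !negb_or.
  by rewrite dvdn_addr ?dvdn_mulr // !gtnNdvd //; lia.
have N1 : (N %% 3 = 1)%N.
  have p3 : (p %% 3 != 0)%N.
    apply/negP => d; have : (3 %| p)%N by [].
    by rewrite dvdn_prime2 // => /eqP p3; move: p_ge5; rewrite -p3.
  have p2 : (p ^ 2 %% 3 = 1)%N.
    rewrite -modnXm; have := ltn_pmod p (isT : (0 < 3)%N).
    by move: p3; case: (p %% 3)%N => [|[|[|r]]].
  (* The summand p of [m] contributes an even power of p, which is 1 modulo 3; the rest is divisible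
     by 3. *)
  have -> : N = (2 * (p * n + i) * p ^ (2 * alpha).+1 * 3 + (p ^ 2) ^ alpha.+1)%N.
    rewrite eN /m -expnM (_ : 2 * alpha.+1 = (2 * alpha).+2)%N; last by lia.
    by rewrite !expnS; ring.
  by rewrite modnMDl -modnXm p2 exp1n.
have noreps : reps N N = [::].
  case E: (reps N N) => [//|[x y] s].
  have : (x, y) \in reps N N by rewrite E mem_head.
  rewrite mem_reps // eN => /idPn[].
  by apply: qform_neq_odd_valuation => //; lia.
have := S9bar_reps N1; rewrite noreps /= => e0.
apply/eqP; rewrite eqz_mod_dvd subr0.
by rewrite (dvdz_pcharf (pchar_Fp (isT : prime 3))) e0.
Qed.
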